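(* Let $(X,\mathbf v)$ be the canonical model, with its topology $\tau$, and let $K$ be the set of all positive linear maps $T:V\to\mathbb R$ with $T(1)=1$. Then assigning to $x\in X$ the map $\phi\mapsto\phi^x$ is a bijection from $X$ onto $K$; $K$ is a convex set which is compact in the weak-star topology (pointwise convergence on $V$); under this bijection the topology $\tau$ of $X$ is weaker than (i.e. contained in) the weak-star topology; and consequently $X$ with the topology $\tau$ is compact (compactness not including the Hausdorff property).
   Context: Syntax. Fix a countable set $\mathbb P$ of atomic propositions. (Affine) propositions are built inductively: $1$, every $p\in\mathbb P$, $\phi+\psi$, $r\phi$ ($r\in\mathbb R$), $\Box\phi$. Abbreviations: a real number $r$ used as a proposition means $r1$ (so $0$ is $0\cdot 1$); $-\phi$ is $(-1)\phi$; $\phi-\psi$ is $\phi+(-1)\psi$. A condition is an expression $\phi\leqslant\psi$ with $\phi,\psi$ propositions; $\phi=\psi$ stands for the two conditions $\phi\leqslant\psi$, $\psi\leqslant\phi$. A theory is a set of conditions. Proof system. Logical axioms (for all propositions $\phi,\psi,\theta$ and reals $r,s$): (A1) $r\leqslant s$, whenever $r\leqslant s$ holds in $\mathbb R$; (A2) $\phi+(\psi+\theta)=(\phi+\psi)+\theta$; (A3) $\phi+\psi=\psi+\phi$; (A4) $0+\phi=\phi$; (A5) $r(\phi+\psi)=r\phi+r\psi$; (A6) $(r+s)\phi=r\phi+s\phi$; (A7) $r(s\phi)=(rs)\phi$; (A8) $1\phi=\phi$; (A9) $0\phi=0$; (A10) $0\leqslant p$ and $p\leqslant 1$ for $p\in\mathbb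 P$; (A11) $\Box(\phi-\psi)\leqslant\Box\phi-\Box\psi$; (A12) $\Box\phi\leqslant\phi$; (A13) $\Box\phi\leqslant\Box\Box\phi$; (A14) $\Box(r\phi)=r\Box\phi$ for $r\geqslant0$; (A15) $\Box r=r$. Rules: (R1) from $\phi\leqslant\psi$ infer $\phi+\theta\leqslant\psi+\theta$; (R2) from $0\leqslant r$ and $\phi\leqslant\psi$ infer $r\phi\leqslant r\psi$; (R3) from $\phi\leqslant\psi$ and $\psi\leqslant\theta$ infer $\phi\leqslant\theta$; (R4) from $\phi\leqslant\psi$ infer $\Box\phi\leqslant\Box\psi$. $\Vdash\mathcal S$ means that the condition $\mathcal S$ is derivable from the logical axioms by finitely many applications of (R1)-(R4). For a theory $\Gamma$: $\Gamma\vdash_0\mathcal S$ if $\Vdash\mathcal S$ or $\mathcal S\in\Gamma$; for $n>0$, $\Gamma\vdash_n\mathcal S$ if for some $k<n$ either $\Gamma\vdash_k\mathcal S$ or $\mathcal S$ follows by one application of (R1), (R2) or (R3) (not (R4)) from conditions $\mathcal S'$ with $\Gamma\vdash_k\mathcal S'$. $\Gamma\vdash\mathcal S$ means $\Gamma\vdash_n\mathcal S$ for some $n$; $\vdash\mathcal S$ means $\emptyset\vdash\mathcal S$ (equivalently $\Vdash\mathcal S$). $\Gamma$ is inconsistent if $\Gamma\vdash 1\leqslant 0$, and consistent otherwise; it is maximal consistent if it is maximal under inclusion among consistent theories. Canonical model. $X$ is the set of all maximal consistent theories. For $x\in X$ and a proposition $\phi$, $\phi^x$ denotes the unique real $r$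 such that $\phi=r$ belongs to $x$ (i.e. both $\phi\leqslant r$ and $r\leqslant\phi$ are in $x$). $\tau$ is the topology on $X$ generated by the sets $B(\phi,r)=\{x\in X: r<(\Box\phi)^x\}$ for $\phi$ a proposition and $r\in\mathbb R$. The valuation is $\mathbf v_p(x)=p^x$. The space $V$. $V$ is the ordered real vector space of propositions, where $\phi,\psi$ are identified if $\vdash\phi=\psi$, and $\phi\leqslant\psi$ in $V$ means $\vdash\phi\leqslant\psi$. A linear map $T:V\to\mathbb R$ is positive if $0\leqslant\phi$ in $V$ implies $0\leqslant T(\phi)$. *)

(* Defs.v *)
From HB Require Import structures.
From mathcomp Require Import all_boot all_order all_algebra.
From mathcomp Require Import all_classical all_reals all_analysis.
Set Implicit Arguments.
Unset Strict Implicit.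
Unset Printing Implicit Defensive.
Import Order.TTheory GRing.Theory Num.Theory.
Import numFieldNormedType.Exports.
Local Open Scope classical_set_scope.
Local Open Scope ring_scope.

Inductive form (R : realType) (P : Type) : Type :=
  | One
  | Atom of P
  | Plus of form R P & form R P
  | Scale of R & form R P
  | Box of form R P.

Arguments One {R P}.
Arguments Atom {R P} p.

(* A condition phi <= psi; phi = psi stands for two conditions. *)
Inductive cond (R : realType) (P : Type) : Type :=
  | Leq of form R P & form R P.

Declare Scope affine_scope.
Delimit Scope affine_scope with AF.
Bind Scope affine_scope with form.
Bind Scope affine_scope with cond.

Notation "phi + psi" := (Plus phi psi) : affine_scope.
Notation "r *: phi" := (Scale r%R phi) : affine_scope.
Notation "- phi" := (Scale (-1)%R phi) : affine_scope.
Notation "phi - psi" := (Plus phi (Scale (-1)%R psi)) : affine_scope.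
(* The real number r used as a proposition; the proposition 0 is 0%:A. *)
Notation "r %:A" := (Scale r%R One) : affine_scope.
Notation "phi <= psi" := (Leq phi psi) : affine_scope.

Section ProofSystem.
Context {R : realType} {P : Type}.
Implicit Types (phi psi theta : form R P) (r s : R) (S : cond R P).

(* The axioms that are equations; Aeq_le and Aeq_ge below turn each one into
   the two conditions that it stands for. *)
Inductive axiom_eq : form R P -> form R P -> Prop :=
  | A2 phi psi theta :
      axiom_eq (phi + (psi + theta)) ((phi + psi) + theta)
  | A3 phi psi : axiom_eq (phi + psi) (psi + phi)
  | A4 phi : axiom_eq (0%:A + phi) phi
  | A5 r phi psi : axiom_eq (r *: (phi + psi)) (r *: phi + r *: psi)
  | A6 r s phi : axiom_eq ((r + s) *: phi) (r *: phi + s *: phi)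
  | A7 r s phi : axiom_eq (r *: (s *: phi)) ((r * s) *: phi)
  | A8 phi : axiom_eq (1 *: phi) phi
  | A9 phi : axiom_eq (0 *: phi) 0%:A
  | A14 r phi : 0 <= r -> axiom_eq (Box (r *: phi)) (r *: Box phi)
  | A15 r : axiom_eq (Box r%:A) r%:A.

Inductive logical_axiom : cond R P -> Prop :=
  | Aeq_le phi psi : axiom_eq phi psi -> logical_axiom (phi <= psi)
  | Aeq_ge phi psi : axiom_eq phi psi -> logical_axiom (psi <= phi)
  | A1 r s : r <= s -> logical_axiom (r%:A <= s%:A)
  | A10l p : logical_axiom (0%:A <= Atom p)
  | A10r p : logical_axiom (Atom p <= 1%:A)
  | A11 phi psi : logical_axiom (Box (phi - psi) <= Box phi - Box psi)
  | A12 phi : logical_axiom (Box phi <= phi)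
  | A13 phi : logical_axiom (Box phi <= Box (Box phi)).

(* One application of a rule other than the monotonicity of Box, to premises
   satisfying D. The premise 0 <= r of R2 is a condition on propositions. *)
Inductive affine_step (D : cond R P -> Prop) : cond R P -> Prop :=
  | R1 phi psi theta : D (phi <= psi)%AF ->
      affine_step D (phi + theta <= psi + theta)
  | R2 r phi psi : D (0%:A <= r%:A)%AF -> D (phi <= psi)%AF ->
      affine_step D (r *: phi <= r *: psi)
  | R3 phi psi theta : D (phi <= psi)%AF -> D (psi <= theta)%AF ->
      affine_step D (phi <= theta).

Inductive thm : cond R P -> Prop :=
  | thm_axiom S : logical_axiom S -> thm S
  | thm_step S : affine_step thm S -> thm S
  | thm_R4 phi psi : thm (phi <= psi) -> thm (Box phi <= Box psi).

Inductive entails_at (Gamma : set (cond R P)) : nat -> cond R P -> Prop :=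
  | entails_thm S : thm S -> entails_at Gamma 0 S
  | entails_hyp S : Gamma S -> entails_at Gamma 0 S
  | entails_keep n k S : (k < n)%N ->
      entails_at Gamma k S -> entails_at Gamma n S
  | entails_step n k S : (k < n)%N ->
      affine_step (entails_at Gamma k) S -> entails_at Gamma n S.

Definition entails (Gamma : set (cond R P)) S := exists n, entails_at Gamma n S.

Definition inconsistent (Gamma : set (cond R P)) :=
  entails Gamma (1%:A <= 0%:A).

Definition consistent (Gamma : set (cond R P)) := ~ inconsistent Gamma.

Definition maximal_consistent (Gamma : set (cond R P)) :=
  consistent Gamma /\
  forall Delta, consistent Delta -> Gamma `<=` Delta -> Delta = Gamma.

Lemma step_mono (D D' : cond R P -> Prop) S :
  (forall S', D S' -> D' S') -> affine_step D S -> affine_step D' S.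
Proof.
move=> DD' [phi psi theta h|r phi psi h h'|phi psi theta h h'].
- exact/R1/DD'.
- by apply: R2; exact: DD'.
- by apply: (@R3 _ _ psi); exact: DD'.
Qed.

Lemma entails_le Gamma m n S :
  (m <= n)%N -> entails_at Gamma m S -> entails_at Gamma n S.
Proof.
rewrite leq_eqVlt => /orP[/eqP->//|mn]; exact: entails_keep.
Qed.

Lemma entails_closed Gamma S :
  affine_step (entails Gamma) S -> entails Gamma S.
Proof.
case=> [phi psi theta [n h]|r phi psi [m h] [n h']|phi psi theta [m h] [n h']].
- by exists n.+1; apply: entails_step (ltnSn n) _; apply: R1.
- exists (maxn m n).+1; apply: entails_step (ltnSn _) _.
  apply: R2.
  + by apply: entails_le h; rewrite leq_maxl.
  + by apply: entails_le h'; rewrite leq_maxr.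
- exists (maxn m n).+1; apply: entails_step (ltnSn _) _.
  apply: (@R3 _ _ psi).
  + by apply: entails_le h; rewrite leq_maxl.
  + by apply: entails_le h'; rewrite leq_maxr.
Qed.

Lemma entails_cut Gamma Delta S :
  (forall S', Delta S' -> entails Gamma S') -> entails Delta S ->
  entails Gamma S.
Proof.
move=> GD [n h]; elim/ltn_ind: n S h => n IH S h.
case: n S / h IH => [S' h _|S' h _|n k S' kn h IH|n k S' kn h IH].
- by exists 0%N; apply: entails_thm.
- exact: GD.
- exact: IH kn _ h.
- by apply: entails_closed; apply: step_mono h => S''; exact: IH.
Qed.

Section Entailment.
Variable Gamma : set (cond R P).
Local Notation "|- S" := (entails Gamma S%AF) (at level 70).

Lemma entails_axiom S : logical_axiom S -> |- S.
Proof. by move=> h; exists 0%N; apply/entails_thm/thm_axiom. Qed.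

Lemma entails_trans psi phi theta :
  |- (phi <= psi) -> |- (psi <= theta) -> |- (phi <= theta).
Proof. by move=> h h'; apply: entails_closed; exact: R3 h h'. Qed.

Lemma entails_addr theta phi psi :
  |- (phi <= psi) -> |- (phi + theta <= psi + theta).
Proof. by move=> h; apply: entails_closed; exact: R1. Qed.

Lemma entails_scale r phi psi :
  0 <= r -> |- (phi <= psi) -> |- (r *: phi <= r *: psi).
Proof.
move=> r0 h; apply: entails_closed; apply: R2 => //.
exact/entails_axiom/A1.
Qed.

Definition entails_eq phi psi := |- (phi <= psi) /\ |- (psi <= phi).

Lemma entails_eq_axiom phi psi : axiom_eq phi psi -> entails_eq phi psi.
Proof.
by move=> h; split; apply: entails_axiom; [exact: Aeq_le|exact: Aeq_ge].
Qed.

Lemma entails_eq_sym phi psi : entails_eq phi psi -> entails_eq psi phi.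
Proof. by case. Qed.

Lemma entails_eq_trans psi phi theta :
  entails_eq phi psi -> entails_eq psi theta -> entails_eq phi theta.
Proof.
move=> [h1 h2] [h3 h4]; split; first exact: entails_trans h1 h3.
exact: entails_trans h4 h2.
Qed.

Lemma entails_eq_refl phi : entails_eq phi phi.
Proof.
have h := entails_eq_axiom (A8 phi).
exact: entails_eq_trans (entails_eq_sym h) h.
Qed.

Lemma entails_eq_add phi phi' psi psi' :
  entails_eq phi phi' -> entails_eq psi psi' ->
  entails_eq (phi + psi) (phi' + psi').
Proof.
have addr a b c : entails_eq a b -> entails_eq (a + c) (b + c).
  by move=> [h1 h2]; split; exact: entails_addr.
have C a b : entails_eq (a + b) (b + a) by exact/entails_eq_axiom/A3.
move=> h h'; apply: (@entails_eq_trans (phi' + psi)); first exact: addr.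
apply: entails_eq_trans (C _ _) _; apply: entails_eq_trans (C _ _).
exact: addr.
Qed.

Lemma entails_eq_addN r phi : entails_eq (r *: phi + (- r) *: phi) 0%:A.
Proof.
apply: entails_eq_trans (entails_eq_sym (entails_eq_axiom (A6 _ _ _))) _.
by rewrite subrr; exact/entails_eq_axiom/A9.
Qed.

Lemma entails_scaleN r phi psi :
  r <= 0 -> |- (phi <= psi) -> |- (r *: psi <= r *: phi).
Proof.
move=> r0 h; have r0' : 0 <= - r by rewrite oppr_ge0.
pose theta := (r *: phi + r *: psi)%AF.
have := entails_addr theta (entails_scale r0' h).
have C a b : entails_eq (a + b) (b + a) by exact/entails_eq_axiom/A3.
have A a b c : entails_eq (a + (b + c)) ((a + b) + c).
  exact/entails_eq_axiom/A2.
have N a b : entails_eq ((- r) *: a + (r *: a + b)) b.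
  apply: entails_eq_trans (A _ _ _) _.
  apply: (@entails_eq_trans (0%:A + b)); last exact/entails_eq_axiom/A4.
  apply: entails_eq_add (entails_eq_refl _).
  exact: entails_eq_trans (C _ _) (entails_eq_addN _ _).
have [_ l] := N phi (r *: psi)%AF.
have [m _] : entails_eq ((- r) *: psi + theta) (r *: phi).
  apply: entails_eq_trans (N psi (r *: phi)%AF).
  by apply: entails_eq_add (C _ _); exact: entails_eq_refl.
by move=> h'; exact: entails_trans l (entails_trans h' m).
Qed.

Lemma entails_eq_scale r phi psi :
  entails_eq phi psi -> entails_eq (r *: phi) (r *: psi).
Proof.
have [r0|/ltW r0] := leP 0 r; move=> [h1 h2]; split;
  by [exact: entails_scale|exact: entails_scaleN].
Qed.

End Entailment.

End ProofSystem.

Section PropositionSpace.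
Context {R : realType} {P : Type}.

HB.instance Definition _ := gen_eqMixin (form R P).
HB.instance Definition _ := gen_choiceMixin (form R P).
HB.instance Definition _ := isPointed.Build (form R P) One.

Definition proveq (phi psi : form R P) : bool :=
  `[< entails set0 (phi <= psi) /\ entails set0 (psi <= phi) >].

Let proveq_refl : reflexive proveq.
Proof. by move=> phi; apply/asboolP/entails_eq_refl. Qed.

Let proveq_sym : symmetric proveq.
Proof. by move=> phi psi; apply/asboolP/asboolP => /entails_eq_sym. Qed.

Let proveq_trans : transitive proveq.
Proof.
by move=> b a c /asboolP h /asboolP h'; apply/asboolP/(entails_eq_trans h h').
Qed.

Canonical proveq_equiv := EquivRel proveq proveq_refl proveq_sym proveq_trans.

End PropositionSpace.

(* The space V of propositions modulo provable equality. *)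
Definition propspace (R : realType) (P : Type) : Type :=
  {eq_quot (@proveq R P)}%qT.

Section PropositionSpaceStructure.
Local Open Scope quotient_scope.
Context {R : realType} {P : Type}.
Local Notation form := (form R P).
Local Notation V := (propspace R P).
Implicit Types (phi psi : form) (u v : V).

HB.instance Definition _ : EqQuotient _ (@proveq R P) V := EqQuotient.on V.
HB.instance Definition _ := Choice.on V.

Lemma propspaceP phi psi :
  entails_eq set0 phi psi <-> \pi_V phi = \pi_V psi.
Proof. by split=> [h|/eqmodP/asboolP//]; apply/eqmodP/asboolP. Qed.

Lemma repr_pi phi : entails_eq set0 (repr (\pi_V phi)) phi.
Proof. by apply/propspaceP; rewrite reprK. Qed.

Definition addV u v : V := \pi_V (repr u + repr v)%AF.
Definition scaleV r u : V := \pi_V (r *: repr u)%AF.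
Definition oneV : V := \pi_V One.
Definition zeroV : V := \pi_V 0%:A%AF.
Definition oppV u : V := scaleV (-1) u.

Lemma pi_addV phi psi : \pi_V (phi + psi)%AF = addV (\pi_V phi) (\pi_V psi).
Proof.
by apply/propspaceP/entails_eq_sym/entails_eq_add; exact: repr_pi.
Qed.

Lemma pi_scaleV r phi : \pi_V (r *: phi)%AF = scaleV r (\pi_V phi).
Proof. exact/propspaceP/entails_eq_sym/entails_eq_scale/repr_pi. Qed.

Let piA phi psi : axiom_eq phi psi -> \pi_V phi = \pi_V psi.
Proof. by move=> h; apply/propspaceP/entails_eq_axiom. Qed.

Let addVA : associative addV.
Proof.
elim/quotW=> a; elim/quotW=> b; elim/quotW=> c.
rewrite -(pi_addV a b) -(pi_addV b c) -(pi_addV a) -(pi_addV _ c).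
exact/piA/A2.
Qed.

Let addVC : commutative addV.
Proof.
by elim/quotW=> a; elim/quotW=> b; rewrite -(pi_addV a) -(pi_addV b);
  exact/piA/A3.
Qed.

Let add0V : left_id zeroV addV.
Proof. by elim/quotW=> a; rewrite -(pi_addV _ a); exact/piA/A4. Qed.

Let scale1V : left_id 1 scaleV.
Proof. by elim/quotW=> a; rewrite -pi_scaleV; exact/piA/A8. Qed.

Let scaleVDl v : {morph scaleV^~ v : r s / r + s >-> addV r s}.
Proof.
elim/quotW: v => a r s; rewrite -!(pi_scaleV _ a) -(pi_addV _ (s *: a)%AF).
exact/piA/A6.
Qed.

Let addNV : left_inverse zeroV oppV addV.
Proof.
move=> u; rewrite -[X in addV _ X]scale1V /oppV -scaleVDl addNr.
by elim/quotW: u => a; rewrite -pi_scaleV; exact/piA/A9.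
Qed.

HB.instance Definition _ := GRing.isZmodule.Build V addVA addVC add0V addNV.

Let scaleVA r s v : scaleV r (scaleV s v) = scaleV (r * s) v.
Proof. by elim/quotW: v => a; rewrite -(pi_scaleV s a) -!pi_scaleV; exact/piA/A7. Qed.

Let scaleVDr : right_distributive scaleV +%R.
Proof.
move=> r; elim/quotW=> a; elim/quotW=> b.
rewrite -[RHS]/(addV _ _) -[X in scaleV r X]/(addV _ _).
rewrite -(pi_addV a b) -!(pi_scaleV r) -(pi_addV (r *: a)%AF).
exact/piA/A5.
Qed.

HB.instance Definition _ :=
  GRing.Zmodule_isLmodule.Build R V scaleVA scale1V scaleVDr scaleVDl.

Definition leV u v : bool := `[< entails set0 (repr u <= repr v) >].

Lemma pi_leV phi psi :
  leV (\pi_V phi) (\pi_V psi) <-> entails set0 (phi <= psi).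
Proof.
have [a b] := repr_pi phi; have [c d] := repr_pi psi.
split=> [/asboolP h|h]; first exact: entails_trans b (entails_trans h c).
by apply/asboolP; exact: entails_trans a (entails_trans h d).
Qed.

Let leV_refl : reflexive leV.
Proof. by move=> u; apply/asboolP; case: (entails_eq_refl set0 (repr u)). Qed.

Let leV_anti : antisymmetric leV.
Proof.
elim/quotW=> a; elim/quotW=> b /andP[/pi_leV ab /pi_leV ba].
exact/propspaceP.
Qed.

Let leV_trans : transitive leV.
Proof.
move=> v u w /asboolP uv /asboolP vw; apply/asboolP.
exact: entails_trans uv vw.
Qed.

HB.instance Definition _ :=
  Order.Le_isPOrder.Build ring_display V leV_refl leV_anti leV_trans.

Lemma pi_le phi psi :
  (\pi_V phi <= \pi_V psi :> V) <-> entails set0 (phi <= psi).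
Proof. exact: pi_leV. Qed.

End PropositionSpaceStructure.

(* The set X of the canonical model. *)
Definition maxtheory (R : realType) (P : Type) : Type :=
  {x : set (cond R P) | maximal_consistent x}.

Section CanonicalModel.
Context {R : realType} {P : Type}.
Local Notation X := (maxtheory R P).
Local Notation V := (propspace R P).
Implicit Types (x : X) (phi : form R P).

(* The value phi^x: the unique real r such that phi = r belongs to x. *)
Definition pval x phi : R :=
  get [set r | sval x (phi <= r%:A)%AF /\ sval x (r%:A <= phi)%AF].

Definition subbaseB (b : form R P * R) : set X :=
  [set x | b.2 < pval x (Box b.1)].

HB.instance Definition _ := gen_eqMixin X.
HB.instance Definition _ := gen_choiceMixin X.
(* The topology tau is generated by the sets B(phi, r). *)
HB.instance Definition _ := isSubBaseTopological.Build X setT subbaseB.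

(* The map phi |-> phi^x on V; evalV_pi states that it does not depend on the
   representatives of the classes. *)
Definition evalV x (u : V) : R := pval x (repr u).

Lemma canonical_entails x S : entails (sval x) S -> sval x S.
Proof.
case: x => x [cx mx] /= xS; rewrite -(mx (x `|` [set S])); first by right.
  move=> h; apply: cx; apply: entails_cut h => S' [xS'|->//].
  by exists 0%N; apply: entails_hyp.
by move=> ?; left.
Qed.

Lemma evalV_pi x phi : evalV x (\pi_V phi)%qT = pval x phi.
Proof.
rewrite /evalV /pval; congr get; rewrite eqEsubset.
have w S : entails set0 S -> entails (sval x) S.
  by apply: entails_cut.
have h S : sval x S -> entails (sval x) S.
  by move=> ?; exists 0%N; apply: entails_hyp.
have [/w a /w b] := repr_pi phi.
split=> r [/h c /h d]; split; apply: canonical_entails.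
- exact: entails_trans b c.
- exact: entails_trans d a.
- exact: entails_trans a c.
- exact: entails_trans d b.
Qed.

(* The set K, as a subset of the space of all functions V -> R; its weak-star
   topology is the one induced by {ptws V -> R}. *)
Definition states : set (V -> R) :=
  [set T : V -> R | [/\ linear (T : V -> R^o),
     forall u, 0 <= u -> 0 <= T u & T oneV = 1]].

End CanonicalModel.

Arguments states R P : clear implicits.
Arguments evalV {R P} x u.

(* Main.v *)
Require Import Defs.
From HB Require Import structures.
From mathcomp Require Import all_boot all_order all_algebra.
From mathcomp Require Import all_classical all_reals all_analysis.
From mathcomp Require Import finmap ring.
Set Implicit Arguments.
Unset Strict Implicit.
Unset Printing Implicit Defensive.
Import Order.TTheory GRing.Theory Num.Theory.
Import numFieldNormedType.Exports.
Local Open Scope classical_set_scope.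
Local Open Scope ring_scope.

(** Up to deducibility, a consistent theory is the same thing as a convex cone
    of V that contains the positive cone and does not contain -1: to Gamma
    corresponds the cone of the u with Gamma proving 0 <= u, and to a cone C
    the set of the conditions phi <= psi with psi - phi in C ([entails_cone],
    [theory_of_closed]). In this picture, adding a condition amounts to adding
    one generator to the cone.

    Let x be a maximal consistent theory, with cone C. If u is not in C, then
    C + R_+ u is not proper, so -1 = c + r u with c in C and r > 0, and hence
    - u - 1/r = c/r is in C: every u is nonnegative or strictly negative in x,
    with a positive real as margin ([maximal_dichotomy]). Every proposition is
    bounded by reals, so u has a supremum s of the reals below it, and the
    margin excludes both u < s and s < u. So u - s is zero in x, which gives
    the value of u, and the remaining algebra says that evaluation at x is a
    positive normalised functional whose half-space of nonnegativity is C;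
    injectivity follows. Conversely, for T in K the half-space where T is
    nonnegative is a proper cone, and its theory is maximal because adding a
    condition phi <= psi with T phi > T psi makes the constant
    T psi - T phi < 0 nonnegative.

    The set K is closed in the product topology and lies in a product of
    compact intervals, so it is compact by Tychonoff's theorem. A subbasic set
    of tau is, through the bijection, the trace on K of the set of the T with
    r < T (Box phi), which is weak-star open; so tau is weaker than the
    weak-star topology, and cluster points in K give cluster points in X. *)

(** * Theories as convex cones *)

Section Cones.
Local Open Scope quotient_scope.
Context {R : realType} {P : Type}.
Local Notation form := (@Defs.form R P).
Local Notation V := (propspace R P).
Local Notation X := (maxtheory R P).
Local Notation pi := (\pi_V).
Implicit Types (phi psi : form) (u v w : V) (C : set V) (r s a b : R).
Implicit Types (x y : X) (Gamma : set (cond R P)).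

Lemma pi_add phi psi : pi (phi + psi)%AF = pi phi + pi psi :> V.
Proof. exact: pi_addV. Qed.

Lemma pi_scale r phi : pi (r *: phi)%AF = r *: pi phi :> V.
Proof. exact: pi_scaleV. Qed.

Lemma pi_real r : pi (r%:A)%AF = r *: oneV :> V.
Proof. exact: pi_scale. Qed.

Lemma entails_weaken Gamma S : entails set0 S -> entails Gamma S.
Proof. exact: entails_cut. Qed.

Lemma entails_pi Gamma phi psi phi' psi' :
  pi phi = pi phi' :> V -> pi psi = pi psi' :> V ->
  entails Gamma (phi <= psi) -> entails Gamma (phi' <= psi').
Proof.
move=> /propspaceP[_ /entails_weaken h] /propspaceP[/entails_weaken h' _] hl.
exact: entails_trans (h _) (entails_trans hl (h' _)).
Qed.

Lemma pi_reprE u : pi (repr u) = u.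
Proof. exact: reprK. Qed.

Definition cone_of Gamma : set V := [set u | entails Gamma (0%:A <= repr u)].

(** Rule R1 moves all of a condition to its right-hand side, so a theory is
    determined, up to deducibility, by its cone. *)
Lemma entails_cone Gamma phi psi :
  entails Gamma (phi <= psi) <-> cone_of Gamma (pi psi - pi phi).
Proof.
split=> [/(entails_addr (- phi)%AF)|/(entails_addr phi)]; apply: entails_pi;
  rewrite ?(pi_add, pi_scale) ?pi_reprE ?scaleN1r ?subrr ?subrK //.
- by rewrite scale0r.
- by rewrite scale0r add0r.
Qed.

Definition cone C :=
  [/\ forall u, 0 <= u -> C u,
      forall u v, C u -> C v -> C (u + v)
    & forall r u, 0 <= r -> C u -> C (r *: u)].

(** A negative real in C would give -1 in C after rescaling. *)
Lemma cone_real_ge0 C r : cone C -> ~ C (- oneV) -> C (r *: oneV) -> 0 <= r.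
Proof.
move=> [_ _ CZ] C1 Cr; rewrite leNgt; apply/negP => r0; apply: C1.
have -> : - oneV = (- r^-1) *: (r *: oneV) :> V.
  by rewrite scalerA mulNr mulVf ?lt_eqF// scaleN1r.
by apply: CZ => //; rewrite oppr_ge0 invr_le0 ltW.
Qed.

Lemma cone_cone_of Gamma : cone (cone_of Gamma).
Proof.
split=> [u|u v hu hv|r u r0 hu].
- rewrite -[u]pi_reprE => /pi_le/entails_weaken h.
  by rewrite /cone_of /= pi_reprE.
- have := entails_addr (repr v) hu; rewrite /cone_of /= => h.
  apply: entails_trans hv _; apply: entails_pi h.
    by rewrite pi_add pi_real scale0r add0r.
  by rewrite pi_add !pi_reprE.
- have := entails_scale r0 hu; apply: entails_pi.
    by rewrite pi_scale pi_real scale0r scaler0.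
  by rewrite pi_scale !pi_reprE.
Qed.

Lemma consistent_cone Gamma : consistent Gamma <-> ~ cone_of Gamma (- oneV).
Proof.
rewrite /consistent /inconsistent entails_cone.
by rewrite !pi_real scale0r scale1r sub0r.
Qed.

Lemma pi_subr_ge0 phi psi :
  entails set0 (phi <= psi) -> 0 <= pi psi - pi phi :> V.
Proof.
by move=> /entails_cone /pi_le; rewrite pi_reprE pi_real scale0r.
Qed.

Lemma oneV_ge0 : 0 <= oneV :> V.
Proof.
have : entails set0 (0%:A <= One : cond R P).
  apply: (@entails_trans _ _ _ 1%:A%AF); first exact/entails_axiom/A1/ler01.
  exact/entails_axiom/Aeq_le/A8.
by move=> /pi_subr_ge0; rewrite pi_real scale0r subr0.
Qed.

Definition theory_of C : set (cond R P) :=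
  [set S | let: Leq phi psi := S in C (pi psi - pi phi)].

(** Rules R1 and R3 are respected by any cone. Rule R2 multiplies by a real r
    that is only known to satisfy 0 <= r in the theory, and properness of C is
    what makes r nonnegative in R. *)
Lemma theory_of_closed C S : cone C -> ~ C (- oneV) ->
  entails (theory_of C) S -> theory_of C S.
Proof.
move=> hC C1 [n h]; have [Cpos CD CZ] := hC; elim/ltn_ind: n S h => n IH S h.
case: n S / h IH => [S h _|S h _|n k S kn h IH|n k S kn h IH].
- case: S h => phi psi h; apply: Cpos; apply: pi_subr_ge0.
  by exists 0%N; exact: entails_thm.
- exact: h.
- exact: IH kn _ h.
- have {IH}h : affine_step (theory_of C) S.
    by apply: step_mono h => S'; exact: IH.
  case: S / h => [phi psi theta|r phi psi|phi psi theta] /=.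
  + by rewrite !pi_add opprD addrACA subrr addr0.
  + rewrite !pi_real scale0r subr0 !pi_scale -scalerBr => Cr; apply: CZ.
    exact: cone_real_ge0 hC C1 Cr.
  + by move=> h1 h2; have := CD _ _ h2 h1; rewrite addrA subrK.
Qed.

Lemma cone_of_theory_of C : cone C -> ~ C (- oneV) -> cone_of (theory_of C) = C.
Proof.
move=> hC C1; rewrite eqEsubset; split=> u.
  by move=> /(theory_of_closed hC C1) /=; rewrite pi_real scale0r subr0 pi_reprE.
move=> Cu; exists 0%N; apply: entails_hyp.
by rewrite /theory_of/= pi_real scale0r subr0 pi_reprE.
Qed.

Lemma theory_of_consistent C : cone C -> ~ C (- oneV) ->
  consistent (theory_of C).
Proof. by move=> hC C1; apply/consistent_cone; rewrite cone_of_theory_of. Qed.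

(** This is where the monotonicity of Box, a rule for theorems only, becomes
    available for conditions entailed by the empty theory. *)
Lemma entails0_thm (S : cond R P) : entails set0 S -> thm S.
Proof.
case=> n h; elim/ltn_ind: n S h => n IH S h.
case: n S / h IH => [//|//|n k S kn h IH|n k S kn h IH].
  exact: IH kn _ h.
by apply: thm_step; apply: step_mono h => S'; exact: IH.
Qed.

(** The real propositions are an order unit: the atoms lie between 0 and 1, and
    Box preserves bounds since it is monotone on theorems and fixes reals. *)
Lemma form_bounded phi : exists a b,
  entails set0 (a%:A <= phi) /\ entails set0 (phi <= b%:A).
Proof.
have real_le r psi psi' : pi psi = r *: oneV :> V ->
    entails set0 (psi <= psi') -> entails set0 (r%:A <= psi').
  by move=> e; apply: entails_pi => //; rewrite pi_real.
have le_real r psi psi' : pi psi = r *: oneV :> V ->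
    entails set0 (psi' <= psi) -> entails set0 (psi' <= r%:A).
  by move=> e; apply: entails_pi => //; rewrite pi_real.
elim: phi => [|p|phi [a [b [ha hb]]] psi [c [d [hc hd]]]|r phi [a [b [ha hb]]]
  |phi [a [b [ha hb]]]].
- exists 1, 1; split.
    exact/entails_axiom/Aeq_le/A8.
  exact/entails_axiom/Aeq_ge/A8.
- by exists 0, 1; split; apply: entails_axiom; [exact: A10l|exact: A10r].
- have add c1 c2 c3 c4 : entails set0 (c1 <= c2) -> entails set0 (c3 <= c4) ->
      entails set0 ((c1 + c3 <= c2 + c4)%AF : cond R P).
    move=> h1 /(entails_addr c2) h2.
    apply: entails_trans (entails_addr c3 h1) _.
    by apply: entails_pi h2; rewrite !pi_add addrC.
  exists (a + c), (b + d); split.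
    by apply: real_le (add _ _ _ _ ha hc); rewrite pi_add !pi_real scalerDl.
  by apply: le_real (add _ _ _ _ hb hd); rewrite pi_add !pi_real scalerDl.
- have piM c : pi (r *: c%:A)%AF = (r * c) *: oneV :> V.
    by rewrite pi_scale pi_real scalerA.
  have [r0|/ltW r0] := leP 0 r.
    exists (r * a), (r * b); split.
      exact: real_le (piM a) (entails_scale r0 ha).
    exact: le_real (piM b) (entails_scale r0 hb).
  exists (r * b), (r * a); split.
    exact: real_le (piM b) (entails_scaleN r0 hb).
  exact: le_real (piM a) (entails_scaleN r0 ha).
- have boxE c : pi (Box (c%:A)%AF) = c *: oneV :> V.
    by rewrite -pi_real; apply/propspaceP/entails_eq_axiom/A15.
  have box psi psi' : entails set0 (psi <= psi') ->
      entails set0 (Box psi <= Box psi').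
    by move=> /entails0_thm h; exists 0%N; apply: entails_thm; exact: thm_R4.
  exists a, b; split.
    exact: real_le (boxE a) (box _ _ ha).
  exact: le_real (boxE b) (box _ _ hb).
Qed.

Lemma propspace_bounded u : exists a b,
  0 <= u - a *: oneV /\ 0 <= b *: oneV - u.
Proof.
have [a [b [/pi_subr_ge0 ha /pi_subr_ge0 hb]]] := form_bounded (repr u).
by exists a, b; rewrite !pi_real pi_reprE in ha hb.
Qed.

(** * Values in a maximal consistent theory *)

Local Notation Cx x := (cone_of (sval x)).

Lemma maxtheoryE x S : sval x S <-> entails (sval x) S.
Proof.
split=> [h|]; last exact: canonical_entails.
by exists 0%N; exact: entails_hyp.
Qed.

(** If u cannot be added to the cone of x, then -1 = c + r u for some c in the
    cone and some r > 0, and dividing by r gives the margin e = 1/r. *)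
Lemma maximal_dichotomy x u :
  Cx x u \/ exists2 e, 0 < e & Cx x (- u - e *: oneV).
Proof.
have [Cpos CD CZ] := cone_cone_of (sval x).
have [cx mx] := svalP x; move: cx => /consistent_cone C1.
(* the cone generated by u and the consequences of x *)
pose C' : set V := [set w | exists c r, [/\ Cx x c, 0 <= r & w = c + r *: u]].
have C'C : cone C'.
  split=> [w w0|_ _ [c [r [hc r0 ->]]] [d [s [hd s0 ->]]]
    |t _ t0 [c [r [hc r0 ->]]]].
  - by exists w, 0; rewrite scale0r addr0; split=> //; exact: Cpos.
  - exists (c + d), (r + s); split; [exact: CD|exact: addr_ge0|].
    by rewrite addrACA -scalerDl.
  - exists (t *: c), (t * r); split; [exact: CZ|exact: mulr_ge0|].
    by rewrite scalerDr scalerA.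
have [[c [r [hc r0 e]]]|C'1] := pselect (C' (- oneV)).
  right; have {}r0 : 0 < r.
    rewrite lt_neqAle r0 andbT; apply/eqP => r_eq0; apply: C1.
    by rewrite e -r_eq0 scale0r addr0.
  (* r = 0 would put -1 in the cone of x, so r is invertible *)
  exists r^-1; first by rewrite invr_gt0.
  suff -> : - u - r^-1 *: oneV = r^-1 *: c.
    by apply: CZ => //; rewrite invr_ge0 ltW.
  have -> : c = - oneV - r *: u by rewrite e addrK.
  by rewrite scalerBr scalerN scalerA mulVf ?gt_eqF// scale1r addrC.
left; rewrite -(mx _ (theory_of_consistent C'C C'1)).
  rewrite cone_of_theory_of//; exists 0, 1; split=> //.
    exact: Cpos.
  by rewrite scale1r add0r.
case=> phi psi /maxtheoryE/entails_cone h.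
by exists (pi psi - pi phi), 0; rewrite scale0r addr0.
Qed.

Lemma maxtheory_real_ge0 x r : Cx x (r *: oneV) -> 0 <= r.
Proof.
have [/consistent_cone C1 _] := svalP x.
exact: cone_real_ge0 (cone_cone_of _) C1.
Qed.

(** The vectors that x identifies with 0. They form a linear subspace, so the
    linearity of the values reduces to their uniqueness. *)
Definition negligible_in x u := Cx x u /\ Cx x (- u).

Lemma negligibleD x u v :
  negligible_in x u -> negligible_in x v -> negligible_in x (u + v).
Proof.
have [_ CD _] := cone_cone_of (sval x).
by move=> [u1 u2] [v1 v2]; split; [|rewrite opprD]; exact: CD.
Qed.

Lemma negligibleZ x r u : negligible_in x u -> negligible_in x (r *: u).
Proof.
have [_ _ CZ] := cone_cone_of (sval x).
move=> [u1 u2]; have [r0|/ltW r0] := leP 0 r.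
  by split; [|rewrite -scalerN]; exact: CZ.
split; last by rewrite -scaleNr; apply: CZ => //; rewrite oppr_ge0.
by rewrite -[r]opprK scaleNr -scalerN; apply: CZ => //; rewrite oppr_ge0.
Qed.

(** The value is the supremum of the reals r with r <= u in x. By
    [maximal_dichotomy], if u - sup is not zero in x then a real larger than
    the supremum is below u, or a smaller one bounds u from above. *)
Lemma value_exists x u : exists r, negligible_in x (u - r *: oneV).
Proof.
have [Cpos CD CZ] := cone_cone_of (sval x).
have [a [b [/Cpos ha /Cpos hb]]] := propspace_bounded u.
pose L := [set r | Cx x (u - r *: oneV)].
have le r s : L r -> Cx x (s *: oneV - u) -> r <= s.
  move=> h h'; rewrite -subr_ge0; apply: (@maxtheory_real_ge0 x).
  by have := CD _ _ h' h; rewrite addrA subrK scalerBl.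
have L0 : L !=set0 by exists a.
have Lub : ubound L b by move=> r /le; exact.
exists (sup L).
have [h|[e e0 h]] := maximal_dichotomy x (u - sup L *: oneV).
  split=> //; have [//|[e e0]] := maximal_dichotomy x (- (u - sup L *: oneV)).
  rewrite opprK -addrA -opprD -scalerDl => h'.
  have : sup L + e <= sup L by apply: ub_le_sup => //; exists b.
  by rewrite gerDl leNgt e0.
have : sup L <= sup L - e.
  apply: ge_sup => // r /le; apply.
  by move: h; rewrite opprB scalerBl addrAC.
by rewrite lerDl oppr_ge0 leNgt e0.
Qed.

Lemma evalVP x u : negligible_in x (u - evalV x u *: oneV).
Proof.
have [r0 [h1 h2]] := value_exists x u.
rewrite /evalV /pval; set A := [set r | _].
have AE r : A r <-> negligible_in x (u - r *: oneV).
  rewrite /A /= !maxtheoryE !entails_cone pi_real pi_reprE.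
  by rewrite /negligible_in opprB; split; case.
have : A (get A) by apply: getPex; exists r0; apply/AE.
by move=> /AE.
Qed.

Lemma evalV_unique x u r : negligible_in x (u - r *: oneV) -> evalV x u = r.
Proof.
move=> h; have := negligibleD (evalVP x u) (negligibleZ (-1) h).
rewrite scaleN1r opprB addrC addrA subrK -scalerBl => -[h1 h2].
apply/eqP; rewrite eq_le -subr_ge0 (maxtheory_real_ge0 h1)/=.
by rewrite -subr_ge0 -opprB (@maxtheory_real_ge0 x) ?scaleNr.
Qed.

Lemma cone_evalV x u : Cx x u <-> 0 <= evalV x u.
Proof.
have [Cpos CD CZ] := cone_cone_of (sval x).
have [h1 h2] := evalVP x u; split=> [h|h].
  apply: (@maxtheory_real_ge0 x).
  by have := CD _ _ h2 h; rewrite opprB subrK.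
rewrite -[u](subrK (evalV x u *: oneV)); apply: CD => //; apply: CZ => //.
exact/Cpos/oneV_ge0.
Qed.

Lemma evalV_states x : states R P (evalV x).
Proof.
have [Cpos _ _] := cone_cone_of (sval x).
split=> [r u v|u u0|].
- apply: evalV_unique.
  have := negligibleD (negligibleZ r (evalVP x u)) (evalVP x v).
  by rewrite scalerBr addrACA scalerA -opprD -scalerDl.
- exact/cone_evalV/Cpos.
- apply: evalV_unique; rewrite scale1r subrr.
  by split; rewrite ?oppr0; apply: Cpos.
Qed.

Lemma evalV_inj : injective (evalV : X -> V -> R).
Proof.
move=> x y exy; have : sval x = sval y.
  rewrite eqEsubset; split=> -[phi psi] /maxtheoryE/entails_cone/cone_evalV h;
  by apply/maxtheoryE/entails_cone/cone_evalV; rewrite ?exy // -exy.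
by case: x y {exy} => [x hx] [y hy] /=; exact: eq_exist.
Qed.

(** The half-space where T is nonnegative gives a maximal theory: a consistent
    extension Delta containing phi <= psi with d = T psi - T phi < 0 would
    prove 0 <= psi - phi, and it proves psi - phi = d since both sides have the
    same image under T, so it would prove 0 <= d. *)
Lemma evalV_surj (T : V -> R) : states R P T -> exists x : X, evalV x = T.
Proof.
move=> [Tlin Tpos T1].
pose F : {linear V -> R^o} := HB.pack T (GRing.isLinear.Build _ _ _ _ T Tlin).
have TB u v : T (u - v) = T u - T v by exact: (raddfB F).
have TZ r u : T (r *: u) = r * T u by exact: (linearZ_LR F).
have TN u : T (- u) = - T u by exact: (raddfN F).
have TD u v : T (u + v) = T u + T v by exact: (raddfD F).
pose C : set V := [set u | 0 <= T u].
have hC : cone C.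
  split=> [//|u v hu hv|r u r0 hu]; rewrite /C /=.
    by rewrite TD addr_ge0.
  by rewrite TZ mulr_ge0.
have C1 : ~ C (- oneV) by rewrite /C/= TN T1 oppr_ge0 ler10.
have mC : maximal_consistent (theory_of C).
  split=> [|Delta cD sD]; first exact: theory_of_consistent.
  rewrite eqEsubset; split=> // -[phi psi] Dh.
  rewrite /theory_of /C /= leNgt; apply/negP => hlt.
  set d := T _ in hlt.
  have [_ CD CZ] := cone_cone_of Delta.
  have /entails_cone h1 : entails Delta (phi <= psi).
    by exists 0%N; exact: entails_hyp.
  have h2 : cone_of Delta (d *: oneV - (pi psi - pi phi)).
    suff : cone_of (theory_of C) (d *: oneV - (pi psi - pi phi)).
      apply: entails_cut => S /sD h.
      by exists 0%N; exact: entails_hyp.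
    by rewrite cone_of_theory_of// /C /= TB TZ T1 mulr1 subrr.
  have := CD _ _ h2 h1; rewrite subrK => /(cone_real_ge0 (cone_cone_of _)).
  by move/consistent_cone: cD => D1 /(_ D1); rewrite leNgt hlt.
exists (exist _ _ mC); apply/funext => u; apply: evalV_unique.
by split; rewrite /= cone_of_theory_of// /C/= ?TN TB TZ T1 mulr1 subrr ?oppr0.
Qed.

End Cones.

(** * Weak-star compactness and the topology tau *)

Section WeakStar.
Context {R : realType} {P : Type}.
Local Notation V := (propspace R P).
Local Notation X := (maxtheory R P).
Local Open Scope convex_scope.
Implicit Types (u v : V) (T : V -> R) (x : X).

Lemma states_convex : @convex_set R (V -> R^o) (states R P).
Proof.
move=> S T k; rewrite !in_setE => -[Slin Spos S1] [Tlin Tpos T1].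
have convE u : (S <| k |> T) u = k%:num * S u + (1 - k%:num) * T u by [].
split=> [r u v|u u0|]; rewrite !convE.
- by rewrite Slin Tlin /GRing.scale /=; ring.
- by rewrite addr_ge0 // mulr_ge0 ?Spos ?Tpos ?subr_ge0.
- by rewrite S1 T1 !mulr1 addrC subrK.
Qed.

Lemma eval_continuous u : continuous (fun T : {ptws V -> R} => T u).
Proof. exact: (@proj_continuous V (fun=> R) u). Qed.

(** For f, g, h the evaluations at r u + v, u and v, this function vanishes at
    the functionals that respect the combination r u + v. *)
Lemma continuous_defect (Y : topologicalType) (r : R) (f g h : Y -> R) :
  continuous f -> continuous g -> continuous h ->
  continuous (fun y => f y - (r * g y + h y)).
Proof.
move=> fc gc hc y; apply: cvgB; first exact: fc.
by apply: cvgD; [apply: cvgM; [exact: cvg_cst|exact: gc]|exact: hc].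
Qed.

Lemma states_closed : closed (states R P : set {ptws V -> R}).
Proof.
pose defect (p : R * V * V) (T : {ptws V -> R}) : R :=
  T (p.1.1 *: p.1.2 + p.2) - (p.1.1 * T p.1.2 + T p.2).
have -> : states R P = \bigcap_(p in setT) (defect p @^-1` [set t | t = 0]) `&`
    \bigcap_(u in [set u | 0 <= u]) ((fun T : {ptws V -> R} => T u) @^-1`
      [set t | 0 <= t]) `&`
    (fun T : {ptws V -> R} => T (@oneV R P)) @^-1` [set t | t = 1].
  apply/seteqP; split=> T.
    move=> [Tlin Tpos T1]; split=> //; split=> // -[[r u] v] _.
    by rewrite /defect /= Tlin subrr.
  move=> [[Tlin Tpos] T1]; split=> // r u v.
  by apply/eqP; rewrite -subr_eq0; apply/eqP/(Tlin (r, u, v)).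
apply: closedI; [apply: closedI|]; [apply: closed_bigI..|].
- move=> p _; apply: preimage_closed; last exact: closed_eq.
  move=> T _.
  exact: (continuous_defect (@eval_continuous _)
    (@eval_continuous _) (@eval_continuous _)).
- move=> u _; apply: preimage_closed; last exact: closed_ge.
  by move=> T _; exact: eval_continuous.
- apply: preimage_closed; last exact: closed_eq.
  by move=> T _; exact: eval_continuous.
Qed.

Lemma states_mono T u v : states R P T -> 0 <= v - u -> T u <= T v.
Proof.
move=> [Tlin Tpos _] /Tpos.
by rewrite addrC -scaleN1r Tlin scaleN1r addrC subr_ge0.
Qed.

Lemma states_real T r : states R P T -> T (r *: (@oneV R P)) = r.
Proof.
move=> [Tlin _ T1].
have T0 : T 0 = 0.
  by apply: (addrI (T 0)); rewrite -{1}[T 0]scale1r -Tlin scale1r !addr0.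
by rewrite -[_ *: _]addr0 Tlin T0 addr0 T1 [LHS]mulr1.
Qed.

(** Positivity and normalisation confine T u to the interval between two reals
    that bound u, independently of T. *)
Lemma states_compact : compact (states R P : set {ptws V -> R}).
Proof.
have /choice[lo /choice[hi lohi]] := @propspace_bounded R P.
apply: subclosed_compact states_closed
  (tychonoff (fun u => @segment_compact R (lo u) (hi u))) _.
move=> T sT u /=; have [h1 h2] := lohi u.
have := states_mono sT h1; have := states_mono sT h2.
by rewrite !states_real // in_itv /= => -> ->.
Qed.

Lemma open_subbase (U : set X) x : open U -> U x ->
  exists2 F : {fset Defs.form R P * R},
    (\bigcap_(i in [set` F]) subbaseB i) x &
    \bigcap_(i in [set` F]) subbaseB i `<=` U.
Proof.
case=> D sD <- [B DB Bx].
have [F _ FB] := sD _ DB.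
exists F; rewrite FB //.
by move=> y By; exists B.
Qed.

(** The witness W is the largest weak-star open set whose trace on K is
    contained in the image of U. Each point of the image belongs to it, because
    a basic neighbourhood in tau is cut out by finitely many inequalities
    r < T (Box phi). *)
Lemma open_weakstar (U : set X) : open U ->
  exists2 W : set {ptws V -> R}, open W & evalV @` U = states R P `&` W.
Proof.
move=> oU; pose N : set {ptws V -> R} := [set T | states R P T -> (evalV @` U) T].
exists (interior N); first exact: open_interior.
apply/seteqP; split=> [_ [x Ux <-]|T [sT /interior_subset]]; last exact.
split; first exact: evalV_states.
have [F Fx FU] := open_subbase oU Ux.
pose e : {ptws V -> R} := evalV x.
have near_F : nbhs e [set T | states R P T ->
    (\bigcap_(i in [set` F])
      [set T : V -> R | i.2 < T (\pi_V (Box i.1))%qT]) T].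
  apply: (filter_bigI_within (F := nbhs e)) => -[phi r] /Fx.
  rewrite /subbaseB /= -evalV_pi => h.
  have near_r := @eval_continuous (\pi_V (Box phi))%qT e _
    (open_nbhs_nbhs (conj (@open_gt _ r) h)).
  by apply: (filterS (F := nbhs e) _ near_r) => T rT _.
apply: (filterS (F := nbhs e) _ near_F) => T h sT.
have [y yT] := evalV_surj sT; exists y => //.
by apply: FU => i Fi; have := h sT i Fi; rewrite /= -yT evalV_pi.
Qed.

(** The image filter clusters at some evalV x in K. Each tau-neighbourhood of x
    contains the trace of a weak-star neighbourhood of evalV x, so x is a
    cluster point of the original filter. *)
Lemma maxtheory_compact : compact [set: X].
Proof.
move=> F FF _.
have FK : (evalV @ F) (states R P : set {ptws V -> R}).
  by apply: (filterS (F := F) _ filterT) => x _; exact: evalV_states.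
have [T [/evalV_surj[x <-] clT]] := states_compact _ FK.
exists x; split=> // A B FA; rewrite nbhsE => -[U [oU Ux] UB].
have [W oW UW] := open_weakstar oU.
have Wx : W (evalV x).
  have : (evalV @` U) (evalV x) by exists x.
  by rewrite UW => -[].
have FA' : (evalV @ F) (evalV @` A : set {ptws V -> R}).
  by apply: (filterS (F := F) _ FA) => y Ay; exists y.
have [_ [[y Ay <-] Wy]] := clT _ _ FA' (open_nbhs_nbhs (conj oW Wx)).
exists y; split=> //; apply: UB.
have : (evalV @` U) (evalV y) by rewrite UW; split=> //; exact: evalV_states.
by move=> [z Uz /evalV_inj <-].
Qed.

End WeakStar.

Theorem mainTheorem5 (R : realType) (P : countType) :
  [/\ set_bij [set: maxtheory R P] (states R P) evalV,
      @convex_set R (propspace R P -> R^o) (states R P),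
      compact (states R P : set {ptws propspace R P -> R}),
      forall U : set (maxtheory R P), open U ->
        exists2 W : set {ptws propspace R P -> R},
          open W & evalV @` U = states R P `&` W
    & compact [set: maxtheory R P] ].
Proof.
split.
- split=> [x _|x y _ _|T /evalV_surj[x <-]]; [exact: evalV_states|exact: evalV_inj|].
  by exists x.
- exact: states_convex.
- exact: states_compact.
- exact: open_weakstar.
- exact: maxtheory_compact.
Qed.
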